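(* Let $\mathbb{D}\in\{\mathbb{R},\mathbb{C},\mathbb{H}\}$, let $\sigma$ be a Kubo-Ando mean on $\mathscr{P}_n(\mathbb{D})$ with representing function $f$, and let $A,B\in\mathscr{P}_n(\mathbb{D})$ be such that $|\mathrm{Spec}(A^{-1}B)|=2$. Then $A\,\sigma\,B$ is linearizable. More precisely, if $\mathrm{Spec}(A^{-1}B)=\{\lambda_1,\lambda_2\}$, then $$A\,\sigma\,B=\frac{\lambda_1 f(\lambda_2)-\lambda_2 f(\lambda_1)}{\lambda_1-\lambda_2}\,A+\frac{f(\lambda_1)-f(\lambda_2)}{\lambda_1-\lambda_2}\,B.$$
   Context: $\mathscr{P}_n(\mathbb{D})$ is the set of $n\times n$ matrices $A$ over $\mathbb{D}$ that are Hermitian ($A=A^*$, with $A^*$ the conjugate transpose) and positive ($x^*Ax>0$ for all nonzero $x\in\mathbb{D}^n$). $\mathrm{Spec}(X)$ is the set of eigenvalues of $X$ (right eigenvalues $\lambda$, $Xv=v\lambda$ with $v\neq 0$, when $\mathbb{D}=\mathbb{H}$), without multiplicity; for $A,B\in\mathscr{P}_n(\mathbb{D})$ one has $\mathrm{Spec}(A^{-1}B)=\mathrm{Spec}(A^{-1/2}BA^{-1/2})\subset(0,\infty)$. For a continuous $f:(0,\infty)\to\mathbb{R}$ and $X=U\,\mathrm{diag}(\lambda_1,\dots,\lambda_n)\,U^*\in\mathscr{P}_n(\mathbb{D})$ with $UU^*=\mathrm{Id}_n$, set $f(X)=U\,\mathrm{diag}(f(\lambda_1),\dots,f(\lambda_n))\,U^*$.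 A Kubo-Ando mean on $\mathscr{P}_n(\mathbb{D})$ is a continuous map $\sigma:\mathscr{P}_n(\mathbb{D})\times\mathscr{P}_n(\mathbb{D})\to\mathscr{P}_n(\mathbb{D})$ that is monotone in both arguments for the Loewner order, satisfies $g(A\,\sigma\,B)g^*=(gAg^* )\,\sigma\,(gBg^* )$ for all $g\in\mathrm{GL}_n(\mathbb{D})$, and satisfies $\mathrm{Id}_n\,\sigma\,\mathrm{Id}_n=\mathrm{Id}_n$. By the Kubo-Ando correspondence, used throughout, it is given by $A\,\sigma\,B=A^{1/2}f(A^{-1/2}BA^{-1/2})A^{1/2}$ for a unique operator monotone function $f:(0,\infty)\to(0,\infty)$ with $f(1)=1$, called its representing function. $A\,\sigma\,B$ is called linearizable if there exist $a,b\in\mathbb{R}$ with $A\,\sigma\,B=aA+bB$. *)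

(* Defs.v *)
From HB Require Import structures.
From mathcomp Require Import all_boot all_order all_algebra ring.
From mathcomp Require Import all_classical all_reals all_analysis.
From mathcomp Require Import complex.

Set Implicit Arguments.
Unset Strict Implicit.
Unset Printing Implicit Defensive.

Import Order.TTheory GRing.Theory Num.Theory.
Import numFieldNormedType.Exports.

Local Open Scope classical_set_scope.
Local Open Scope ring_scope.

(* Compatibility of the operations with the topology is not part of the
   structure: it only serves as a common type for R, R[i] and quaternion R. *)
#[short(type="topNzRingType")]
HB.structure Definition TopNzRing := {T of GRing.NzRing T & Topological T}.

Record quaternion (R : Type) : Type :=
  Quaternion { q1 : R; qi : R; qj : R; qk : R }.

Section QuaternionChoice.
Variable R : Type.

Definition quat_coords (x : quaternion R) : R * R * R * R :=
  let: Quaternion a b c d := x in (a, b, c, d).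

Definition quat_of_coords (x : R * R * R * R) : quaternion R :=
  let: (a, b, c, d) := x in Quaternion a b c d.

Lemma quat_coordsK : cancel quat_coords quat_of_coords.
Proof. by case. Qed.

End QuaternionChoice.

HB.instance Definition _ (R : eqType) :=
  Equality.copy (quaternion R) (can_type (@quat_coordsK R)).
HB.instance Definition _ (R : choiceType) :=
  Choice.copy (quaternion R) (can_type (@quat_coordsK R)).

Section QuaternionRing.
Variable R : realType.
Local Notation H := (quaternion R).

Definition addq (x y : H) : H :=
  let: Quaternion a b c d := x in let: Quaternion a' b' c' d' := y in
  Quaternion (a + a') (b + b') (c + c') (d + d').

Definition oppq (x : H) : H :=
  let: Quaternion a b c d := x in Quaternion (- a) (- b) (- c) (- d).

Definition mulq (x y : H) : H :=
  let: Quaternion a b c d := x in let: Quaternion a' b' c' d' := y in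
  Quaternion (a * a' - b * b' - c * c' - d * d')
             (a * b' + b * a' + c * d' - d * c')
             (a * c' - b * d' + c * a' + d * b')
             (a * d' + b * c' - c * b' + d * a').

Definition conjq (x : H) : H :=
  let: Quaternion a b c d := x in Quaternion a (- b) (- c) (- d).

Definition realq (a : R) : H := Quaternion a 0 0 0.

Lemma addqA : associative addq.
Proof. by move=> [????] [????] [????] /=; rewrite !addrA. Qed.

Lemma addqC : commutative addq.
Proof. by move=> [????] [????] /=; congr Quaternion; rewrite addrC. Qed.

Lemma add0q : left_id (realq 0) addq.
Proof. by move=> [????] /=; rewrite !add0r. Qed.

Lemma addNq : left_inverse (realq 0) oppq addq.
Proof. by move=> [????] /=; rewrite !addNr. Qed.

HB.instance Definition _ := GRing.isZmodule.Build H addqA addqC add0q addNq.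

Lemma mulqA : associative mulq.
Proof. by move=> [????] [????] [????] /=; congr Quaternion; ring. Qed.

Lemma mul1q : left_id (realq 1) mulq.
Proof. by move=> [????] /=; congr Quaternion; ring. Qed.

Lemma mulq1 : right_id (realq 1) mulq.
Proof. by move=> [????] /=; congr Quaternion; ring. Qed.

Lemma mulqDl : left_distributive mulq +%R.
Proof. by move=> [????] [????] [????]; congr Quaternion; ring. Qed.

Lemma mulqDr : right_distributive mulq +%R.
Proof. by move=> [????] [????] [????]; congr Quaternion; ring. Qed.

Lemma oneq_neq0 : realq 1 != 0.
Proof. by apply/eqP => -[] /eqP; rewrite oner_eq0. Qed.

HB.instance Definition _ :=
  GRing.Zmodule_isNzRing.Build H mulqA mul1q mulq1 mulqDl mulqDr oneq_neq0.

HB.instance Definition _ :=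
  Topological.copy H (initial_topology (@quat_coords R)).

End QuaternionRing.

HB.instance Definition _ (R : realType) := Topological.on (Real.sort R).
HB.instance Definition _ (R : realType) := Topological.copy R[i] R[i]^o.

Inductive division_algebra := RealNumbers | ComplexNumbers | Quaternions.

Definition scalars (R : realType) (K : division_algebra) : topNzRingType :=
  match K with
  | RealNumbers => R
  | ComplexNumbers => R[i]
  | Quaternions => quaternion R
  end.

Section PositiveMatrices.
Variables (R : realType) (K : division_algebra).
Local Notation D := (scalars R K).

Definition conj_scalar : D -> D :=
  match K return scalars R K -> scalars R K with
  | RealNumbers => id
  | ComplexNumbers => @conjc R
  | Quaternions => @conjq R
  end.

Definition of_real : R -> D :=
  match K return R -> scalars R K with
  | RealNumbers => id
  | ComplexNumbers => fun a => Complex a 0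
  | Quaternions => @realq R
  end.

Definition adjmx m n (A : 'M[D]_(m, n)) : 'M[D]_(n, m) :=
  (map_mx conj_scalar A)^T.

Definition hermitian_mx n (A : 'M[D]_n) : Prop := A = adjmx A.

Definition quadform n (A : 'M[D]_n) (x : 'cV[D]_n) : D :=
  (adjmx x *m A *m x) 0 0.

(* A sign condition on an element of D includes that the element is real. *)
Definition posdef n : set 'M[D]_n :=
  [set A | hermitian_mx A /\ forall x : 'cV[D]_n, x != 0 ->
     exists2 r : R, 0 < r & quadform A x = of_real r].

Definition possemidef n : set 'M[D]_n :=
  [set A | hermitian_mx A /\ forall x : 'cV[D]_n,
     exists2 r : R, 0 <= r & quadform A x = of_real r].

Definition loewner n (A B : 'M[D]_n) : Prop := possemidef (B - A).

Definition is_inverse n (A A' : 'M[D]_n) : Prop :=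
  A *m A' = 1%:M /\ A' *m A = 1%:M.

Definition GL n : set 'M[D]_n := [set g | exists g', is_inverse g g'].

(* [invmx] is only available over commutative rings, hence not over the
   quaternions; the value is 0 when A is not invertible. *)
Definition inv_mx n (A : 'M[D]_n) : 'M[D]_n := xget 0 [set A' | is_inverse A A'].

(* Right eigenvalues: [v *m l%:M] is the column v multiplied by l on the right. *)
Definition Spec n (X : 'M[D]_n) : set D :=
  [set l | exists2 v : 'cV[D]_n, v != 0 & X *m v = v *m l%:M].

Definition udiag n (U : 'M[D]_n) (l : 'rV[R]_n) : 'M[D]_n :=
  U *m diag_mx (map_mx of_real l) *m adjmx U.

(* f(X) for X = U diag(l) U^*, with U U^* = Id; the value does not depend on the
   choice of U and l, and it is 0 when X has no such decomposition. *)
Definition matfun n (f : R -> R) (X : 'M[D]_n) : 'M[D]_n :=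
  xget 0 [set Y | exists (U : 'M[D]_n) (l : 'rV[R]_n),
    [/\ U *m adjmx U = 1%:M, X = udiag U l & Y = udiag U (map_mx f l)]].

Definition sqrt_mx n : 'M[D]_n -> 'M[D]_n := matfun Num.sqrt.
Definition invsqrt_mx n : 'M[D]_n -> 'M[D]_n :=
  matfun (fun t => (Num.sqrt t)^-1).

(* A function (0, oo) -> R is a function on R whose values outside (0, oo) are
   irrelevant. *)
Definition operator_monotone (f : R -> R) : Prop :=
  {within `]0, +oo[, continuous f} /\
  forall m (X Y : 'M[D]_m), posdef X -> posdef Y ->
    loewner X Y -> loewner (matfun f X) (matfun f Y).

(* A map P_n x P_n -> P_n is a binary operation on all matrices whose values
   outside P_n x P_n are irrelevant. *)
Record Kubo_Ando_mean n (sigma : 'M[D]_n -> 'M[D]_n -> 'M[D]_n) : Prop := {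
  mean_posdef : forall A B, posdef A -> posdef B -> posdef (sigma A B);
  mean_continuous : {within @posdef n `*` @posdef n,
    continuous (fun AB : 'M[D]_n * 'M[D]_n => sigma AB.1 AB.2)};
  mean_monotone : forall A A' B B',
    posdef A -> posdef A' -> posdef B -> posdef B' ->
    loewner A A' -> loewner B B' -> loewner (sigma A B) (sigma A' B');
  mean_congruence : forall g A B, GL g -> posdef A -> posdef B ->
    g *m sigma A B *m adjmx g =
      sigma (g *m A *m adjmx g) (g *m B *m adjmx g);
  mean_id : sigma 1%:M 1%:M = 1%:M
}.

Record representing_function n (sigma : 'M[D]_n -> 'M[D]_n -> 'M[D]_n)
    (f : R -> R) : Prop := {
  representing_pos : forall t, 0 < t -> 0 < f t;
  representing_monotone : operator_monotone f;
  representing1 : f 1 = 1;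
  representingE : forall A B, posdef A -> posdef B ->
    sigma A B =
      sqrt_mx A *m matfun f (invsqrt_mx A *m B *m invsqrt_mx A) *m sqrt_mx A
}.

Definition rscale n (a : R) (A : 'M[D]_n) : 'M[D]_n := of_real a *: A.

Definition linearizable n (sigma : 'M[D]_n -> 'M[D]_n -> 'M[D]_n)
    (A B : 'M[D]_n) : Prop :=
  exists a b : R, sigma A B = rscale a A + rscale b B.

End PositiveMatrices.

(* Main.v *)
(* Put C = A^{-1/2} B A^{-1/2}. Each diagonal entry m of a unitary
   diagonalization of C is an eigenvalue of A^{-1} B, so it equals l1 or l2,
   where f agrees with the affine function a + b t interpolating it at l1 and
   l2. Hence f(C) = a Id + b C, and A^{1/2} f(C) A^{1/2} = a A + b B. *)

Require Import Defs.
From mathcomp Require Import all_boot all_order all_algebra ring.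
From mathcomp Require Import all_classical all_reals all_analysis.
From mathcomp Require Import complex.

Set Implicit Arguments.
Unset Strict Implicit.
Unset Printing Implicit Defensive.

Import Order.TTheory GRing.Theory Num.Theory.
Import numFieldNormedType.Exports.

Local Open Scope classical_set_scope.
Local Open Scope ring_scope.

(** * Conjugation, real elements and real parts in the three scalar rings *)

Section Scalars.
Context {R : realType} {K : division_algebra}.
Implicit Types (x y : scalars R K) (a b : R).

Lemma of_realD a b : of_real K (a + b) = of_real K a + of_real K b.
Proof.
case: K => //=; first by congr Complex; rewrite addr0.
by congr Quaternion; rewrite addr0.
Qed.

Lemma of_realM a b : of_real K (a * b) = of_real K a * of_real K b.
Proof. by case: K => //=; [congr Complex|congr Quaternion]; ring. Qed.

Lemma of_real0 : of_real K (0 : R) = 0.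
Proof. by case: K. Qed.

Lemma of_real1 : of_real K (1 : R) = 1.
Proof. by case: K. Qed.

Lemma of_real_inj : injective (@of_real R K).
Proof. by case: K => // a b []. Qed.

Lemma of_real_comm a x : of_real K a * x = x * of_real K a.
Proof.
case: K x => [x|[x1 x2]|[x1 x2 x3 x4]] /=; first exact: mulrC.
  by congr Complex; ring.
by congr Quaternion; ring.
Qed.

(** The scalars are seen only as a ring, so the nonzero real factor is cancelled by the image of its
    real inverse. *)
Lemma of_real_mul_eq0 a x : a != 0 -> of_real K a * x = 0 -> x = 0.
Proof.
move=> a0 ax0; rewrite -[x]mul1r -of_real1 -(mulVf a0) of_realM -mulrA ax0.
exact: mulr0.
Qed.

Lemma conj_scalarD x y :
  conj_scalar (x + y) = conj_scalar x + conj_scalar y.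
Proof.
case: K x y => [//|[x1 x2] [y1 y2]|[x1 x2 x3 x4] [y1 y2 y3 y4]] /=.
  by congr Complex; rewrite opprD.
by congr Quaternion; rewrite opprD.
Qed.

Lemma conj_scalarM x y :
  conj_scalar (x * y) = conj_scalar y * conj_scalar x.
Proof.
case: K x y => [x y|[x1 x2] [y1 y2]|[x1 x2 x3 x4] [y1 y2 y3 y4]] /=.
- exact: mulrC.
- by congr Complex; ring.
- by congr Quaternion; ring.
Qed.

Lemma conj_scalarK : involutive (@conj_scalar R K).
Proof.
by case: K => [//|[x1 x2]|[x1 x2 x3 x4]] /=; rewrite !opprK.
Qed.

Lemma conj_of_real a : conj_scalar (of_real K a) = of_real K a.
Proof. by case: K => //=; rewrite oppr0. Qed.

(** Over the quaternions only the real part of a product is symmetric in the two factors, so traces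
    are compared through it. *)
Definition re_scalar : scalars R K -> R :=
  match K return scalars R K -> R with
  | RealNumbers => id
  | ComplexNumbers => fun z => let: Complex a _ := z in a
  | Quaternions => @q1 R
  end.

Lemma re_scalarD x y : re_scalar (x + y) = re_scalar x + re_scalar y.
Proof.
by rewrite /re_scalar; case: K x y => [//|[x1 x2] [y1 y2]|[????] [????]].
Qed.

Lemma re_scalar0 : re_scalar 0 = 0.
Proof. by rewrite /re_scalar; case: K. Qed.

Lemma re_scalarC x y : re_scalar (x * y) = re_scalar (y * x).
Proof.
rewrite /re_scalar.
by case: K x y => [x y|[x1 x2] [y1 y2]|[????] [????]] /=; ring.
Qed.

Lemma re_scalar_sqr_ge0 x : 0 <= re_scalar (conj_scalar x * x).
Proof.
rewrite /re_scalar; case: K x => [x|[x1 x2]|[x1 x2 x3 x4]] /=.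
- by rewrite -expr2 sqr_ge0.
- by rewrite mulNr opprK -!expr2 addr_ge0 ?sqr_ge0.
- by rewrite !mulNr !opprK -!expr2 !addr_ge0 ?sqr_ge0.
Qed.

Lemma re_scalar_sqr_eq0 x : re_scalar (conj_scalar x * x) = 0 -> x = 0.
Proof.
rewrite /re_scalar; case: K x => [x|[x1 x2]|[x1 x2 x3 x4]] /=.
- by move/eqP; rewrite -expr2 sqrf_eq0 => /eqP.
- move/eqP; rewrite mulNr opprK -!expr2 paddr_eq0 ?sqr_ge0 // !sqrf_eq0.
  by move=> /andP[/eqP -> /eqP ->].
- move/eqP; rewrite !mulNr !opprK -!expr2 !paddr_eq0 ?addr_ge0 ?sqr_ge0 //.
  by rewrite !sqrf_eq0 => /andP[/andP[/andP[/eqP -> /eqP ->] /eqP ->] /eqP ->].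
Qed.

End Scalars.

(** * Adjoints and the real trace *)

Section Matrices.
Context {R : realType} {K : division_algebra}.
Local Notation D := (scalars R K).

Lemma conj_scalar0 : conj_scalar (0 : D) = 0.
Proof. by rewrite -of_real0 conj_of_real. Qed.

Lemma conj_scalar_nat (b : bool) : conj_scalar (b%:R : D) = b%:R.
Proof.
by case: b; rewrite ?conj_scalar0 // -[1%:R]of_real1 conj_of_real.
Qed.

Lemma of_realN (a : R) : of_real K (- a) = - of_real K a.
Proof. by apply/eqP; rewrite -addr_eq0 -of_realD addNr of_real0. Qed.

Lemma adjmxM m n p (A : 'M[D]_(m, n)) (B : 'M[D]_(n, p)) :
  adjmx (A *m B) = adjmx B *m adjmx A.
Proof.
apply/matrixP => i j; rewrite !mxE.
rewrite (big_morph _ conj_scalarD conj_scalar0).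
by apply: eq_bigr => k _; rewrite !mxE conj_scalarM.
Qed.

Lemma adjmxK m n (A : 'M[D]_(m, n)) : adjmx (adjmx A) = A.
Proof. by apply/matrixP => i j; rewrite !mxE conj_scalarK. Qed.

Lemma adjmxB m n (A B : 'M[D]_(m, n)) : adjmx (A - B) = adjmx A - adjmx B.
Proof.
apply/matrixP => i j; rewrite !mxE conj_scalarD; congr (_ + _).
by apply/eqP; rewrite -addr_eq0 -conj_scalarD addNr conj_scalar0.
Qed.

Lemma adjmx1 n : adjmx (1%:M : 'M[D]_n) = 1%:M.
Proof. by apply/matrixP => i j; rewrite !mxE conj_scalar_nat eq_sym. Qed.

Lemma adjmx_delta m n i j :
  adjmx (delta_mx i j : 'M[D]_(m, n)) = delta_mx j i.
Proof. by apply/matrixP => k l; rewrite !mxE conj_scalar_nat andbC. Qed.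

Lemma re_mxtraceC m n (A : 'M[D]_(m, n)) (B : 'M[D]_(n, m)) :
  re_scalar (\tr (A *m B)) = re_scalar (\tr (B *m A)).
Proof.
rewrite /mxtrace !(big_morph _ re_scalarD re_scalar0).
under eq_bigr do rewrite mxE (big_morph _ re_scalarD re_scalar0).
under [RHS]eq_bigr do rewrite mxE (big_morph _ re_scalarD re_scalar0).
rewrite exchange_big; apply: eq_bigr => i _.
by apply: eq_bigr => j _; rewrite re_scalarC.
Qed.

(** The real trace of [adjmx A *m A] is the sum of the squared norms of the entries of [A]. *)
Lemma re_mxtrace_adj_eq0 m n (A : 'M[D]_(m, n)) :
  re_scalar (\tr (adjmx A *m A)) = 0 -> A = 0.
Proof.
rewrite /mxtrace (big_morph _ re_scalarD re_scalar0).
under eq_bigr do rewrite mxE (big_morph _ re_scalarD re_scalar0).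
have ge0 k i : 0 <= re_scalar (adjmx A i k * A k i).
  by rewrite !mxE re_scalar_sqr_ge0.
move=> /eqP; rewrite psumr_eq0 => [/allP s0|i _]; last exact: sumr_ge0.
apply/matrixP => i j; rewrite [RHS]mxE.
have /= := s0 j (mem_index_enum _).
rewrite psumr_eq0 // => /allP /(_ i (mem_index_enum _)) /=.
by rewrite !mxE => /eqP /re_scalar_sqr_eq0.
Qed.

(* [1 - U^* U] is a Hermitian projection, and its real trace equals that of
   [1 - U U^* = 0]. *)
Lemma adjmx_mulC n (U : 'M[D]_n) :
  U *m adjmx U = 1%:M -> adjmx U *m U = 1%:M.
Proof.
move=> UU; apply/esym/eqP; rewrite -subr_eq0; apply/eqP.
set E := _ - _.
have EE : adjmx E *m E = E.
  have PP : adjmx U *m U *m (adjmx U *m U) = adjmx U *m U.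
    by rewrite mulmxA -(mulmxA (adjmx U)) UU mulmx1.
  rewrite adjmxB adjmx1 adjmxM adjmxK mulmxBl mul1mx mulmxBr mulmx1 PP.
  by rewrite subrr subr0.
apply: re_mxtrace_adj_eq0; rewrite EE.
have tr0 : re_scalar (\tr (1%:M : 'M[D]_n)) = re_scalar (\tr (adjmx U *m U)).
  by rewrite re_mxtraceC UU.
apply: (addIr (re_scalar (\tr (adjmx U *m U)))).
by rewrite -re_scalarD -raddfD /= subrK tr0 add0r.
Qed.

(** * Functional calculus on unitary diagonalizations *)

Lemma udiagM n (U : 'M[D]_n) (l m : 'rV[R]_n) : U *m adjmx U = 1%:M ->
  udiag U l *m udiag U m = udiag U (\row_i (l 0 i * m 0 i)).
Proof.
move=> /adjmx_mulC UU; rewrite /udiag !mulmxA.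
rewrite -[_ *m adjmx U *m U]mulmxA UU mulmx1 -!mulmxA.
congr (_ *m _); rewrite mulmxA; congr (_ *m _); rewrite mulmx_diag.
by congr diag_mx; apply/rowP => i; rewrite !mxE of_realM.
Qed.

Lemma udiag1 n (U : 'M[D]_n) : U *m adjmx U = 1%:M ->
  udiag U (const_mx 1) = 1%:M.
Proof.
by move=> UU; rewrite /udiag map_const_mx of_real1 diag_const_mx mulmx1.
Qed.

(** Entrywise the hypothesis reads $(l_i - k_j) w_{ij} = 0$, because reals are central. Either $l_i
    = k_j$, and [f] takes the same value at both, or $w_{ij} = 0$. *)
Lemma diag_mx_intertwine_map m n (l : 'rV[R]_m) (k : 'rV[R]_n)
    (W : 'M[D]_(m, n)) (f : R -> R) :
  diag_mx (map_mx (of_real K) l) *m W = W *m diag_mx (map_mx (of_real K) k) ->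
  diag_mx (map_mx (of_real K) (map_mx f l)) *m W =
  W *m diag_mx (map_mx (of_real K) (map_mx f k)).
Proof.
move=> WE; apply/matrixP => i j; move/matrixP: WE => /(_ i j).
rewrite !mul_diag_mx !mul_mx_diag !mxE.
have [->|lDk] := eqVneq (l 0 i) (k 0 j); first by rewrite !of_real_comm.
have lk0 : l 0 i - k 0 j != 0 by rewrite subr_eq0.
rewrite -of_real_comm => /eqP; rewrite -subr_eq0 -mulrBl -of_realN -of_realD.
by move=> /eqP /(of_real_mul_eq0 lk0) ->; rewrite mulr0 mul0r.
Qed.

(* [V^* U] intertwines the two diagonal matrices. *)
Lemma udiag_map n (U V : 'M[D]_n) (l m : 'rV[R]_n) (f : R -> R) :
  U *m adjmx U = 1%:M -> V *m adjmx V = 1%:M ->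
  udiag U l = udiag V m -> udiag U (map_mx f l) = udiag V (map_mx f m).
Proof.
move=> UU VV UlVm.
have UU' := adjmx_mulC UU; have VV' := adjmx_mulC VV.
set W := adjmx V *m U.
have WE : diag_mx (map_mx (of_real K) m) *m W =
          W *m diag_mx (map_mx (of_real K) l).
  have := congr1 (fun X => adjmx V *m X *m U) UlVm.
  by rewrite /udiag !mulmxA VV' mul1mx -!mulmxA UU' mulmx1 /W mulmxA => <-.
have {}WE := diag_mx_intertwine_map f WE.
rewrite /udiag.
transitivity (V *m W *m diag_mx (map_mx (of_real K) (map_mx f l)) *m adjmx U).
  by rewrite /W mulmxA VV mul1mx.
by rewrite -(mulmxA V) -WE /W !mulmxA -(mulmxA _ U) UU mulmx1.
Qed.

(** By [udiag_map] all diagonalizations give one value, which is therefore the one that [xget]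
    picks. *)
Lemma matfunE n (U : 'M[D]_n) (l : 'rV[R]_n) (f : R -> R) :
  U *m adjmx U = 1%:M -> matfun f (udiag U l) = udiag U (map_mx f l).
Proof.
move=> UU; apply: xget_unique => [|Y [V [m [VV UlVm ->]]]].
  by exists U, l.
exact/esym/udiag_map.
Qed.

(** This takes the place of the spectral theorem: a nonzero value is not the default of [xget], so a
    diagonalization exists. *)
Lemma matfun_neq0 n (f : R -> R) (X : 'M[D]_n) : matfun f X != 0 ->
  exists (U : 'M[D]_n) (l : 'rV[R]_n), U *m adjmx U = 1%:M /\ X = udiag U l.
Proof.
rewrite /matfun.
case: xgetP => [_ _ [U [l [UU XE _]]] _|_]; last by rewrite eqxx.
by exists U, l.
Qed.

(** * Columns of the unitary factor as right eigenvectors *)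

Lemma mul_udiag_delta n (U : 'M[D]_n) (l : 'rV[R]_n) i :
  U *m adjmx U = 1%:M -> udiag U l *m (U *m delta_mx i (0 : 'I_1)) =
  U *m delta_mx i (0 : 'I_1) *m (of_real K (l 0 i))%:M.
Proof.
move=> /adjmx_mulC UU; rewrite /udiag -mulmxA (mulmxA (adjmx U)) UU mul1mx.
rewrite -!mulmxA; congr (_ *m _); apply/matrixP => j k.
rewrite mul_diag_mx -diag_const_mx mul_mx_diag !mxE -of_real_comm.
by have [->|] := eqVneq j i; rewrite ?mulr0.
Qed.

Lemma unitary_delta_neq0 n (U : 'M[D]_n) (i : 'I_n) :
  U *m adjmx U = 1%:M -> U *m delta_mx i (0 : 'I_1) != 0.
Proof.
move=> /adjmx_mulC UU; apply/eqP => /(congr1 (mulmx (adjmx U))) /matrixP.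
rewrite mulmxA UU mul1mx mulmx0 => /(_ i 0) /eqP.
by rewrite !mxE !eqxx oner_eq0.
Qed.

(** The quadratic form at column [i] of [U] takes the value [l 0 i]. *)
Lemma posdef_udiag_gt0 n (U : 'M[D]_n) (l : 'rV[R]_n) i :
  U *m adjmx U = 1%:M -> posdef (udiag U l) -> 0 < l 0 i.
Proof.
move=> UU [_] /(_ _ (unitary_delta_neq0 i UU)) [r r0].
rewrite /quadform -mulmxA mul_udiag_delta // adjmxM adjmx_delta !mulmxA.
rewrite -(mulmxA _ (adjmx U)) (adjmx_mulC UU) mulmx1 mul_delta_mx.
rewrite -diag_const_mx mul_mx_diag !mxE !eqxx mul1r => /of_real_inj ->.
exact: r0.
Qed.

(** The vector excludes size 0, where the zero matrix is positive definite. *)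
Lemma posdef_neq0 n (A : 'M[D]_n) (v : 'cV[D]_n) : v != 0 -> posdef A -> A != 0.
Proof.
move=> v0 [_ /(_ v v0) [r r0]]; apply: contraPneq => -> /=.
rewrite /quadform mulmx0 mul0mx mxE -of_real0 => /of_real_inj r00.
by rewrite -r00 ltxx in r0.
Qed.

(** * Inverses, square roots and real eigenvalues *)

Lemma inv_mxP n (A A' : 'M[D]_n) : is_inverse A A' -> is_inverse A (inv_mx A).
Proof. exact: xgetI. Qed.

Lemma posdef_udiag_inverse n (U : 'M[D]_n) (l : 'rV[R]_n) :
  U *m adjmx U = 1%:M -> posdef (udiag U l) ->
  is_inverse (udiag U l) (udiag U (map_mx GRing.inv l)).
Proof.
move=> UU Ul; rewrite /is_inverse !udiagM //.
by split; rewrite -(udiag1 UU); congr udiag; apply/rowP => i;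
  rewrite !mxE ?mulfV ?mulVf // gt_eqF // (posdef_udiag_gt0 i UU Ul).
Qed.

Lemma sqrt_mxK n (U : 'M[D]_n) (l : 'rV[R]_n) :
  U *m adjmx U = 1%:M -> posdef (udiag U l) ->
  sqrt_mx (udiag U l) *m sqrt_mx (udiag U l) = udiag U l.
Proof.
move=> UU Ul; rewrite /sqrt_mx matfunE // udiagM //.
congr udiag; apply/rowP => i; rewrite !mxE -expr2 sqr_sqrtr //.
exact/ltW/(posdef_udiag_gt0 i UU Ul).
Qed.

Lemma sqrt_mx_inverse n (U : 'M[D]_n) (l : 'rV[R]_n) :
  U *m adjmx U = 1%:M -> posdef (udiag U l) ->
  is_inverse (sqrt_mx (udiag U l)) (invsqrt_mx (udiag U l)).
Proof.
move=> UU Ul; rewrite /is_inverse /sqrt_mx /invsqrt_mx !matfunE // !udiagM //.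
by split; rewrite -(udiag1 UU); congr udiag; apply/rowP => i;
  rewrite !mxE ?mulfV ?mulVf // gt_eqF // sqrtr_gt0 (posdef_udiag_gt0 i UU Ul).
Qed.

(** From $Bv = Avx$ follows $v^*Bv = (v^*Av)x$, where both forms are real and positive. *)
Lemma Spec_invM_real n (A B A' : 'M[D]_n) x :
  is_inverse A A' -> posdef A -> posdef B -> Spec (A' *m B) x ->
  exists r : R, x = of_real K r.
Proof.
move=> [AA' _] [_ Apos] [_ Bpos] [v v0 /(congr1 (mulmx A))].
rewrite !mulmxA AA' mul1mx => Bv.
have [s s0 As] := Apos v v0; have [r r0 Br] := Bpos v v0.
exists (s^-1 * r); rewrite of_realM -Br /quadform -mulmxA Bv !mulmxA.
rewrite -diag_const_mx mul_mx_diag mxE [(_ *m v) 0 0]As [const_mx _ _ _]mxE.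
by rewrite mulrA -of_realM mulVf ?gt_eqF // of_real1 mul1r.
Qed.

Lemma mulmx_rscale n (a : R) (A B : 'M[D]_n) :
  A *m rscale a B = rscale a (A *m B).
Proof.
apply/matrixP => i j; rewrite !mxE mulr_sumr; apply: eq_bigr => k _.
by rewrite mxE !mulrA of_real_comm.
Qed.

(** Writing the identity as [udiag U (const_mx 1)] puts both summands in the same basis, where the
    claim concerns diagonal entries only. *)
Lemma udiag_affine n (U : 'M[D]_n) (l : 'rV[R]_n) (f : R -> R) (a b : R) :
  U *m adjmx U = 1%:M -> (forall i, f (l 0 i) = a + b * l 0 i) ->
  udiag U (map_mx f l) = rscale a 1%:M + rscale b (udiag U l).
Proof.
move=> UU fl; rewrite -(udiag1 UU) /rscale /udiag.
have rscaleE c (m : 'rV[R]_n) :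
    of_real K c *: (U *m diag_mx (map_mx (of_real K) m) *m adjmx U) =
    U *m diag_mx (map_mx (of_real K) (\row_i (c * m 0 i))) *m adjmx U.
  rewrite scalemxAl -/(rscale c _) -mulmx_rscale; congr (_ *m _ *m _).
  by apply/matrixP => i j; rewrite !mxE of_realM mulrnAr.
rewrite !rscaleE -mulmxDl -mulmxDr -raddfD /=.
congr (_ *m diag_mx _ *m _); apply/rowP => i.
by rewrite !mxE fl -of_realD mulr1.
Qed.

Lemma card_I2_set2 (T : Type) (S : set T) : (S #= `I_2)%card ->
  exists x y, x <> y /\ S = [set x; y].
Proof.
move=> /card_set_bijP[g [gS ginj gsurj]].
(* The two elements are the preimages of 0 and 1 under the bijection. *)
have [//|x Sx gx] := gsurj 0%N; have [//|y Sy gy] := gsurj 1%N.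
exists x, y; split; first by move=> xy; rewrite xy gy in gx.
apply/seteqP; split => [z Sz|z [->|->]] //.
have := gS z Sz; case gz: (g z) => [|[|k]] // _; [left|right].
  by apply: ginj; rewrite ?inE // gz gx.
by apply: ginj; rewrite ?inE // gz gy.
Qed.

End Matrices.

(** * Linearization for a two-point spectrum *)

Theorem proposition3p1 (R : realType) (K : division_algebra) (n : nat)
    (sigma : 'M[scalars R K]_n -> 'M[scalars R K]_n -> 'M[scalars R K]_n)
    (f : R -> R) (A B : 'M[scalars R K]_n) :
  Kubo_Ando_mean sigma ->
  representing_function sigma f ->
  posdef A -> posdef B ->
  (Spec (inv_mx A *m B) #= `I_2)%card ->
  linearizable sigma A B /\
  forall l1 l2 : R,
    Spec (inv_mx A *m B) = [set of_real K l1; of_real K l2] ->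
    sigma A B =
      rscale ((l1 * f l2 - l2 * f l1) / (l1 - l2)) A +
      rscale ((f l1 - f l2) / (l1 - l2)) B.
Proof.
move=> mean_sigma repr_f Apos Bpos /card_I2_set2 [x [y [xNy SpecE]]].
(* The eigenvector serves only as a nonzero vector, to make [sigma A B] nonzero. *)
have [v v0 _] : Spec (inv_mx A *m B) x by rewrite SpecE; left.
have AsB : sigma A B = _ := representingE repr_f Apos Bpos.
have sAB0 := posdef_neq0 v0 (mean_posdef mean_sigma Apos Bpos).
(* The junk value 0 of [matfun] lets the spectral decompositions be read off
   from the representing formula, as [sigma A B] is not 0. *)
have [U [l [UU AE]]] : exists (U : 'M[scalars R K]_n) (l : 'rV[R]_n),
    U *m adjmx U = 1%:M /\ A = udiag U l.
  apply: (@matfun_neq0 _ _ _ Num.sqrt); apply: contraNneq sAB0 => sqrtA0.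
  by rewrite AsB /sqrt_mx sqrtA0 mulmx0.
have [V [m [VV CE]]] : exists (V : 'M[scalars R K]_n) (m : 'rV[R]_n),
    V *m adjmx V = 1%:M /\ invsqrt_mx A *m B *m invsqrt_mx A = udiag V m.
  apply: (@matfun_neq0 _ _ _ f); apply: contraNneq sAB0 => fC0.
  by rewrite AsB fC0 mulmx0 mul0mx.
have Apos' := Apos; rewrite AE in Apos'.
have [AA' A'A] : is_inverse A (inv_mx A).
  by rewrite AE; apply/inv_mxP/posdef_udiag_inverse.
have := sqrt_mxK UU Apos'; have := sqrt_mx_inverse UU Apos'; rewrite -AE.
set S := sqrt_mx A in AsB *; set T := invsqrt_mx A in AsB CE *.
move=> [ST TS] SS.
have SpecV i : Spec (inv_mx A *m B) (of_real K (m 0 i)).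
  (* Let $w = Ve_i$, so $TBTw = w m_i$. Multiplying by $S = T^{-1}$ gives $BTw = Sw m_i$, and
     $A^{-1}S = T$ because $A = SS$. *)
  exists (T *m (V *m delta_mx i 0)).
    apply: contraNneq (unitary_delta_neq0 i VV) => TV0.
    by rewrite -[_ *m _]mul1mx -ST -mulmxA TV0 mulmx0.
  have := congr1 (mulmx S) (mul_udiag_delta m i VV).
  rewrite -CE !mulmxA ST mul1mx => BTV.
  rewrite -!mulmxA in BTV *; rewrite BTV -[in RHS](mul1mx T) -A'A.
  by rewrite -SS !mulmxA -(mulmxA _ S T) ST mulmx1.
have sigmaE l1 l2 : Spec (inv_mx A *m B) = [set of_real K l1; of_real K l2] ->
    sigma A B =
      rscale ((l1 * f l2 - l2 * f l1) / (l1 - l2)) A +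
      rscale ((f l1 - f l2) / (l1 - l2)) B.
  move=> Spec12.
  (* Equal values would make the spectrum a single point, against [xNy]. *)
  have l12 : l1 - l2 != 0.
    rewrite subr_eq0; apply/eqP => l12; apply: xNy.
    have := SpecE; rewrite Spec12 l12 setUid => E.
    have : [set x; y] x by left.
    have : [set x; y] y by right.
    by rewrite -E => -> ->.
  (* Here [a] and [b] are the intercept and slope of the line through $(l_1, f(l_1))$ and $(l_2,
     f(l_2))$. *)
  rewrite AsB CE matfunE // (udiag_affine
    (a := (l1 * f l2 - l2 * f l1) / (l1 - l2))
    (b := (f l1 - f l2) / (l1 - l2))) //.
    rewrite mulmxDr mulmxDl !mulmx_rscale /rscale -!scalemxAl mulmx1 SS -CE.
    by rewrite !mulmxA ST mul1mx -(mulmxA B) TS mulmx1.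
  move=> i; have := SpecV i; rewrite Spec12.
  by case=> /of_real_inj ->; field.
split=> //.
(* The cardinality only gives two points of the scalar ring; they must be real before [sigmaE]
   applies. *)
have [l1 xE] : exists r, x = of_real K r.
  by apply: (Spec_invM_real (conj AA' A'A) Apos Bpos); rewrite SpecE; left.
have [l2 yE] : exists r, y = of_real K r.
  by apply: (Spec_invM_real (conj AA' A'A) Apos Bpos); rewrite SpecE; right.
rewrite xE yE in SpecE; do 2 eexists; exact: sigmaE SpecE.
Qed.
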